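(* For all worms $A$ and $B$: $A \vdash_{\mathsf{RC}} B$ if and only if $A \vdash_{\mathsf{WC}} B$.
   Context: Closed strictly positive formulas are built from the constant $\top$ using the binary connective $\land$ and unary modalities $\langle\alpha\rangle$, one for each ordinal $\alpha$. Formulas of $\mathsf{RC}$ may in addition contain propositional variables. Worms are the formulas built from $\top$ using only the modalities: $\top$ is a worm, and if $A$ is a worm and $\alpha$ an ordinal then $\langle\alpha\rangle A$ (abbreviated $\alpha A$) is a worm. So a worm is a finite string of ordinals followed by $\top$; the final $\top$ is usually not written, and for worms $A,B$ the concatenation $AB$ is the worm obtained by replacing the final $\top$ of $A$ by $B$. $\mathbb{W}_\alpha$ is the class of worms all of whose modalities are $\geq\alpha$ (so $\top\in\mathbb{W}_\alpha$). Reflection Calculus $\mathsf{RC}$: derives sequents $\varphi\vdash_{\mathsf{RC}}\psi$ between strictly positive formulas. Axioms: $\varphi\vdash\varphi$; $\varphi\vdash\top$; $\varphi\land\psi\vdash\varphi$; $\varphi\land\psi\vdash\psi$; $\langle\alpha\rangle\langle\alpha\rangle\varphi\vdash\langle\alpha\rangle\varphi$; $\langle\alpha\rangle\varphi\vdash\langle\beta\rangle\varphi$ for $\alpha>\beta$; $\langle\alpha\rangle\varphi\land\langle\beta\rangle\psi\vdash\langle\alpha\rangle(\varphi\land\langle\beta\rangle\psi)$ for $\alpha>\beta$. Rules: from $\varphi\vdash\psi$ and $\psi\vdash\chi$ infer $\varphi\vdash\chi$; from $\varphi\vdash\psi$ and $\varphi\vdash\chi$ infer $\varphi\vdash\psi\land\chi$;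 from $\varphi\vdash\psi$ infer $\langle\alpha\rangle\varphi\vdash\langle\alpha\rangle\psi$. Worm Calculus $\mathsf{WC}$: derives sequents $A\vdash_{\mathsf{WC}}B$ between worms. Axioms: $A\vdash\top$; $\alpha\alpha A\vdash\alpha A$; $\alpha A\vdash\beta A$ for $\alpha>\beta$. Rules: from $A\vdash B$ and $B\vdash C$ infer $A\vdash C$; from $A\vdash B$ infer $\alpha A\vdash\alpha B$; from $A\vdash B$ and $A\vdash\alpha C$ infer $A\vdash B\alpha C$, provided $B\in\mathbb{W}_{\alpha+1}$. *)

(* Defs.v *)
(* Plain Stdlib, no MathComp. *)
From Stdlib Require Import List.
Import ListNotations.

Set Implicit Arguments.

(** * Ordinals, as order types of well-orders *)

Record wellOrder := WellOrder {
  wo_sort :> Type;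
  wo_lt : wo_sort -> wo_sort -> Prop;
  wo_trans : forall x y z, wo_lt x y -> wo_lt y z -> wo_lt x z;
  wo_total : forall x y, wo_lt x y \/ x = y \/ wo_lt y x;
  wo_wf : well_founded wo_lt
}.

Definition wo_iso (v w : wellOrder) : Prop :=
  exists (f : v -> w) (g : w -> v),
    (forall x, g (f x) = x) /\ (forall y, f (g y) = y) /\
    (forall x y, wo_lt v x y <-> wo_lt w (f x) (f y)).

Lemma wo_iso_refl v : wo_iso v v.
Proof. exists (fun x => x), (fun x => x); firstorder. Qed.

Lemma wo_iso_sym v w : wo_iso v w -> wo_iso w v.
Proof.
intros (f & g & fK & gK & fm); exists g, f; repeat split; auto; intros h.
- apply fm; rewrite !gK; exact h.
- apply fm in h; rewrite !gK in h; exact h.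
Qed.

Lemma wo_iso_trans u v w : wo_iso u v -> wo_iso v w -> wo_iso u w.
Proof.
intros (f & g & fK & gK & fm) (f' & g' & fK' & gK' & fm').
exists (fun x => f' (f x)), (fun z => g (g' z)); split; [|split].
- intros x; rewrite fK'; apply fK.
- intros z; rewrite gK; apply gK'.
- intros x y; rewrite fm; apply fm'.
Qed.

(* An ordinal is an isomorphism class of well-orders.  Leibniz equality of
   ordinals is equality of order types, by propositional and functional
   extensionality. *)
Definition is_order_type (P : wellOrder -> Prop) : Prop :=
  exists w, forall v, P v <-> wo_iso w v.

Definition ordinal : Type := {P : wellOrder -> Prop | is_order_type P}.

Definition has_type (w : wellOrder) (a : ordinal) : Prop := proj1_sig a w.

(* [a < b] iff [a] is the order type of a proper initial segment of [b]. *)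
Definition olt (a b : ordinal) : Prop :=
  exists (v w : wellOrder) (f : v -> w) (t : w),
    has_type v a /\ has_type w b /\
    (forall x y, wo_lt v x y <-> wo_lt w (f x) (f y)) /\
    (forall y, wo_lt w y t <-> exists x, f x = y).

Definition ole (a b : ordinal) : Prop := olt a b \/ a = b.

(* [w + 1]: the new point [None] lies above all of [w]. *)
Definition succ_lt (w : wellOrder) (x y : option w) : Prop :=
  match x, y with
  | Some x, Some y => wo_lt w x y
  | Some _, None => True
  | None, _ => False
  end.

Lemma succ_lt_trans w x y z : succ_lt w x y -> succ_lt w y z -> succ_lt w x z.
Proof.
destruct x, y, z; simpl; try tauto; apply wo_trans.
Qed.

Lemma succ_lt_total w x y : succ_lt w x y \/ x = y \/ succ_lt w y x.
Proof.
destruct x as [x|], y as [y|]; simpl; auto.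
destruct (wo_total w x y) as [h|[->|h]]; auto.
Qed.

Lemma succ_lt_wf w : well_founded (succ_lt w).
Proof.
assert (h : forall x, Acc (succ_lt w) (Some x)).
{ intros x; induction (wo_wf w x) as [x _ IH]; constructor.
  intros [y|]; simpl; [apply IH | intros []]. }
intros [x|]; [apply h | constructor].
intros [y|]; [intros _; apply h | intros []].
Qed.

Definition wo_succ (w : wellOrder) : wellOrder :=
  {| wo_lt := succ_lt w; wo_trans := succ_lt_trans w;
     wo_total := succ_lt_total w; wo_wf := succ_lt_wf w |}.

Lemma wo_succ_iso v w : wo_iso v w -> wo_iso (wo_succ v) (wo_succ w).
Proof.
intros (f & g & fK & gK & fm); exists (option_map f), (option_map g).
split; [|split].
- intros [x|]; simpl; [rewrite fK|]; reflexivity.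
- intros [y|]; simpl; [rewrite gK|]; reflexivity.
- intros [x|] [y|]; simpl; [apply fm| | |]; reflexivity.
Qed.

Lemma is_order_type_succ (a : ordinal) :
  is_order_type (fun u => exists w, has_type w a /\ wo_iso (wo_succ w) u).
Proof.
destruct a as [P [w hw]]; exists (wo_succ w).
intros u; split.
- intros (v & hv & hu).
  apply wo_iso_trans with (wo_succ v); [apply wo_succ_iso, hw, hv | exact hu].
- intros hu; exists w; split; [apply hw, wo_iso_refl | exact hu].
Qed.

Definition osucc (a : ordinal) : ordinal := exist _ _ (is_order_type_succ a).

(** * Strictly positive formulas and the Reflection Calculus *)

Inductive form (V : Type) : Type :=
| Var (p : V)
| Top
| And (phi psi : form V)
| Dia (a : ordinal) (phi : form V).

Arguments Top {V}.

Inductive RC (V : Type) : form V -> form V -> Prop :=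
| RC_refl phi : RC phi phi
| RC_top phi : RC phi Top
| RC_andl phi psi : RC (And phi psi) phi
| RC_andr phi psi : RC (And phi psi) psi
| RC_dia_trans a phi : RC (Dia a (Dia a phi)) (Dia a phi)
| RC_dia_mono a b phi : olt b a -> RC (Dia a phi) (Dia b phi)
| RC_dia_and a b phi psi : olt b a ->
    RC (And (Dia a phi) (Dia b psi)) (Dia a (And phi (Dia b psi)))
| RC_cut phi psi chi : RC phi psi -> RC psi chi -> RC phi chi
| RC_and phi psi chi : RC phi psi -> RC phi chi -> RC phi (And psi chi)
| RC_nec a phi psi : RC phi psi -> RC (Dia a phi) (Dia a psi).

(** * Worms and the Worm Calculus *)

(* A worm is the string of its modalities, the final [Top] left implicit;
   concatenation of worms is [++]. *)
Definition worm : Type := list ordinal.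

Definition worm_form (V : Type) (A : worm) : form V :=
  fold_right (@Dia V) Top A.

(* The class [W_a] of worms all of whose modalities are at least [a]. *)
Definition worm_ge (a : ordinal) (A : worm) : Prop := Forall (ole a) A.

Inductive WC : worm -> worm -> Prop :=
| WC_top A : WC A []
| WC_trans a A : WC (a :: a :: A) (a :: A)
| WC_mono a b A : olt b a -> WC (a :: A) (b :: A)
| WC_cut A B C : WC A B -> WC B C -> WC A C
| WC_nec a A B : WC A B -> WC (a :: A) (a :: B)
| WC_app a A B C : worm_ge (osucc a) B ->
    WC A B -> WC A (a :: C) -> WC A (B ++ a :: C).

(* Main.v *)
(* Soundness of WC in RC is a direct induction.  For the converse, let a worm X
   force <a>phi when X |-_WC aA for some worm A forcing phi, and treat
   conjunction classically; the worms forcing a worm B are exactly those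
   deriving it in WC.  RC is sound for forcing, and the only axiom that takes
   work is <a>phi /\ <b>psi |- <a>(phi /\ <b>psi): when X derives aA and bB with
   b < a, one needs a worm C deriving A and bB with X |- aC.  Cut A and bB at the
   first occurrence of their least modality m.  The parts before the cut are
   handled by induction on length, and the remainders, which begin with m, are
   comparable in WC. *)

Require Import Defs.
From Stdlib Require Import List Lia Wf_nat Classical ClassicalEpsilon.
From Stdlib Require Import FunctionalExtensionality PropExtensionality.
Import ListNotations.

(** * The order of the ordinals *)

Lemma has_type_ex (a : ordinal) : exists w, has_type w a.
Proof.
destruct a as [P [w hw]]; exists w; apply hw, wo_iso_refl.
Qed.

Lemma has_type_iso a v w : has_type v a -> (has_type w a <-> wo_iso v w).
Proof.
destruct a as [P [u hu]]; unfold has_type; simpl; intros hv.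
apply hu in hv; rewrite hu; split; intros h.
- exact (wo_iso_trans (wo_iso_sym hv) h).
- exact (wo_iso_trans hv h).
Qed.

Lemma has_type_inj a b v : has_type v a -> has_type v b -> a = b.
Proof.
intros ha hb.
assert (e : proj1_sig a = proj1_sig b).
{ apply functional_extensionality; intros w; apply propositional_extensionality.
  exact (iff_trans (has_type_iso a v w ha) (iff_sym (has_type_iso b v w hb))). }
destruct a as [P p], b as [Q q]; simpl in e; subst Q.
f_equal; apply proof_irrelevance.
Qed.

Lemma wo_irrefl (w : wellOrder) x : ~ wo_lt w x x.
Proof.
induction (wo_wf w x) as [x _ IH]; intros h; exact (IH x h h).
Qed.

Lemma wo_least (w : wellOrder) (P : w -> Prop) :
  (exists x, P x) -> exists x, P x /\ forall y, wo_lt w y x -> ~ P y.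
Proof.
intros [x hx]; apply NNPP; intros hn; revert hx.
induction (wo_wf w x) as [x _ IH]; intros hx.
apply hn; exists x; split; [exact hx | exact IH].
Qed.

Lemma embedding_reflects (v w : wellOrder) (f : v -> w) :
  (forall x y, wo_lt v x y -> wo_lt w (f x) (f y)) ->
  forall x y, wo_lt v x y <-> wo_lt w (f x) (f y).
Proof.
intros fm x y; split; [apply fm | intros h].
destruct (wo_total v x y) as [l|[->|l]]; [exact l | |].
- destruct (wo_irrefl _ _ h).
- destruct (wo_irrefl _ _ (wo_trans _ _ _ _ h (fm _ _ l))).
Qed.

(** The image of [f] is an initial segment: either all of [w], or what lies below the least point
    that [f] omits. *)
Lemma initial_embedding_ole a b (v w : wellOrder) (f : v -> w) :
  has_type v a -> has_type w b ->
  (forall x y, wo_lt v x y -> wo_lt w (f x) (f y)) ->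
  (forall x y, wo_lt w y (f x) -> exists x', f x' = y) -> ole a b.
Proof.
intros ha hb fm fd.
pose proof (embedding_reflects v w f fm) as fr.
destruct (classic (exists y, forall x, f x <> y)) as [hy|hy].
- left; destruct (wo_least w _ hy) as (t & ht & tmin).
  exists v, w, f, t; repeat split; auto; try apply fr.
  + intros l; apply NNPP; intros n; apply (tmin _ l).
    intros x e; apply n; exists x; exact e.
  + intros [x <-]; destruct (wo_total w (f x) t) as [l|[e|l]]; [exact l| |].
    * destruct (ht x e).
    * destruct (fd _ _ l) as [x' e]; destruct (ht x' e).
- right; apply has_type_inj with w; [|exact hb].
  apply (has_type_iso a v w ha).
  assert (surj : forall y, exists x, f x = y).
  { intros y; apply NNPP; intros n; apply hy; exists y.
    intros x e; apply n; exists x; exact e. }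
  pose (g y := proj1_sig (constructive_indefinite_description _ (surj y))).
  assert (gK : forall y, f (g y) = y).
  { intros y; exact (proj2_sig (constructive_indefinite_description _ (surj y))). }
  exists f, g; split; [|split]; [|exact gK | exact fr].
  intros x; destruct (wo_total v (g (f x)) x) as [l|[e|l]]; [|exact e|];
    apply fm in l; rewrite gK in l; destruct (wo_irrefl _ _ l).
Qed.

Lemma olt_irrefl a : ~ olt a a.
Proof.
intros (v & w & f & t & hv & hw & fm & ft).
destruct (proj1 (has_type_iso a w v hw) hv) as (g & k & _ & _ & gm).
(* An order-preserving self-map of a well-order moves no point down, yet [f (g t)] lies below
   [t]. *)
assert (D : forall x, ~ wo_lt w (f (g x)) x).
{ intros x; induction (wo_wf w x) as [x _ IH]; intros l.
  apply (IH _ l); apply fm, gm; exact l. }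
apply (D t), ft; exists (g t); reflexivity.
Qed.

Lemma olt_trans a b c : olt a b -> olt b c -> olt a c.
Proof.
intros (v & w & f & t & hv & hw & fm & ft) (w' & u & g & s & hw' & hu & gm & gs).
destruct (proj1 (has_type_iso b w w' hw) hw') as (h & k & hK & kK & hm).
exists v, u, (fun x => g (h (f x))), (g (h t)); split; [exact hv|].
split; [exact hu|split].
- intros x y; rewrite fm, hm, gm; reflexivity.
- intros y; split.
  + intros l.
    destruct (proj1 (gs y)) as [z <-].
    { apply wo_trans with (g (h t)); [exact l | apply gs; exists (h t); reflexivity]. }
    rewrite <- gm, <- (kK z), <- hm in l; apply ft in l; destruct l as [x e].
    exists x; rewrite e, kK; reflexivity.
  + intros [x <-]; rewrite <- gm, <- hm; apply ft; exists x; reflexivity.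
Qed.

(* The bisimilarity of the initial segments below two points: the partial
   isomorphism along which two well-orders are compared. *)
Inductive same_rank (v w : wellOrder) (x : v) (y : w) : Prop :=
| same_rank_intro :
    (forall x', wo_lt v x' x -> exists y', wo_lt w y' y /\ same_rank v w x' y') ->
    (forall y', wo_lt w y' y -> exists x', wo_lt v x' x /\ same_rank v w x' y') ->
    same_rank v w x y.

Lemma same_rank_sym v w x y : same_rank v w x y -> same_rank w v y x.
Proof.
revert y; induction (wo_wf v x) as [x _ IH]; intros y [h h']; constructor.
- intros y' l; destruct (h' y' l) as (x' & l' & r); eauto.
- intros x' l; destruct (h x' l) as (y' & l' & r); eauto.
Qed.

Lemma same_rank_functional v w x y y' :
  same_rank v w x y -> same_rank v w x y' -> y = y'.
Proof.
revert y y'; induction (wo_wf v x) as [x _ IH].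
(* If [y < y'] both match [x], then [y] matches some [x1 < x], and [x1] matches some [y1 < y];
   uniqueness at [x1] gives [y1 = y]. *)
assert (H : forall y y', same_rank v w x y -> same_rank v w x y' ->
              ~ wo_lt w y y').
{ intros y y' [h _] [_ h'] l.
  destruct (h' y l) as (x1 & l1 & r1); destruct (h x1 l1) as (y1 & l2 & r2).
  rewrite (IH x1 l1 y1 y r2 r1) in l2; exact (wo_irrefl _ _ l2). }
intros y y' r r'; destruct (wo_total w y y') as [l|[e|l]]; [|exact e|].
- destruct (H y y' r r' l).
- destruct (H y' y r' r l).
Qed.

Lemma same_rank_total_ole a b v w :
  has_type v a -> has_type w b ->
  (forall x, exists y, same_rank v w x y) -> ole a b.
Proof.
intros ha hb tot.
pose (f x := proj1_sig (constructive_indefinite_description _ (tot x))).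
assert (fr : forall x, same_rank v w x (f x)).
{ intros x; exact (proj2_sig (constructive_indefinite_description _ (tot x))). }
apply initial_embedding_ole with v w f; auto.
- intros x x' l; destruct (fr x') as [h _]; destruct (h x l) as (y & ly & r).
  rewrite (same_rank_functional _ _ _ _ _ (fr x) r); exact ly.
- intros x y l; destruct (fr x) as [_ h]; destruct (h y l) as (x' & lx & r).
  exists x'; exact (same_rank_functional _ _ _ _ _ (fr x') r).
Qed.

Lemma olt_total a b : olt a b \/ a = b \/ olt b a.
Proof.
destruct (has_type_ex a) as [v hv], (has_type_ex b) as [w hw].
(* Otherwise each order has a least unmatched point, and these two points match each other. *)
assert (H : (forall x, exists y, same_rank v w x y) \/
            (forall y, exists x, same_rank w v y x)).
{ apply NNPP; intros n; apply not_or_and in n; destruct n as [nv nw].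
  apply not_all_ex_not, wo_least in nv; destruct nv as (x & nx & xmin).
  apply not_all_ex_not, wo_least in nw; destruct nw as (y & ny & ymin).
  apply nx; exists y; constructor.
  - intros x' l; destruct (NNPP _ (xmin x' l)) as [y' r].
    exists y'; split; [|exact r].
    (* If the partner [y'] were [y] or above it, [y] would have a partner too. *)
    destruct (wo_total w y' y) as [l'|[->|l']]; [exact l'| |]; destruct ny.
    + exists x'; exact (same_rank_sym _ _ _ _ r).
    + destruct r as [_ h]; destruct (h y l') as (x1 & _ & r1).
      exists x1; exact (same_rank_sym _ _ _ _ r1).
  - intros y' l; destruct (NNPP _ (ymin y' l)) as [x' r].
    exists x'; split; [|exact (same_rank_sym _ _ _ _ r)].
    destruct (wo_total v x' x) as [l'|[->|l']]; [exact l'| |]; destruct nx.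
    + exists y'; exact (same_rank_sym _ _ _ _ r).
    + destruct r as [_ h]; destruct (h x l') as (y1 & _ & r1).
      exists y1; exact (same_rank_sym _ _ _ _ r1). }
destruct H as [H|H].
- destruct (same_rank_total_ole a b v w hv hw H); auto.
- destruct (same_rank_total_ole b a w v hw hv H); auto.
Qed.

Lemma has_type_osucc a w : has_type w a -> has_type (wo_succ w) (osucc a).
Proof. intros h; exists w; split; [exact h | apply wo_iso_refl]. Qed.

(** Turns the side condition of [WC_app] into a strict bound on modalities. *)
Lemma osucc_ole a b : ole (osucc a) b <-> olt a b.
Proof.
split.
- assert (l : olt a (osucc a)).
  { destruct (has_type_ex a) as [w hw].
    exists w, (wo_succ w), Some, None; split; [exact hw|].
    split; [apply has_type_osucc, hw|]; split; [reflexivity|].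
    intros [y|]; simpl; split; try tauto; [eauto|].
    intros [x e]; discriminate. }
  intros [h|<-]; [exact (olt_trans _ _ _ l h) | exact l].
- intros (v & w & f & t & hv & hw & fm & ft).
  (* The added top point goes to [t], the first point above the image of [f]. *)
  apply initial_embedding_ole with (wo_succ v) w
    (fun x => match x with Some x => f x | None => t end);
    [apply has_type_osucc, hv | exact hw | |].
  + intros [x|] [y|]; simpl; try tauto; [apply fm|].
    intros _; apply ft; exists x; reflexivity.
  + assert (H : forall y, wo_lt w y t -> exists x' : wo_succ v,
                  match x' with Some x => f x | None => t end = y).
    { intros y l; apply ft in l; destruct l as [x e]; exists (Some x); exact e. }
    intros [x|] y l; apply H; [|exact l].
    apply wo_trans with (f x); [exact l | apply ft; exists x; reflexivity].
Qed.

Lemma ole_olt_trans a b c : ole a b -> olt b c -> olt a c.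
Proof. intros [h| ->]; [exact (olt_trans _ _ _ h) | auto]. Qed.

Lemma ole_trans a b c : ole a b -> ole b c -> ole a c.
Proof.
intros h [l|<-]; [left; exact (ole_olt_trans _ _ _ h l) | exact h].
Qed.

(** * Worms *)

Definition worm_gt (a : ordinal) (A : worm) : Prop := Forall (olt a) A.

Lemma worm_ge_osucc a A : worm_ge (osucc a) A <-> worm_gt a A.
Proof.
split; apply Forall_impl; intros b; apply osucc_ole.
Qed.

Lemma worm_ge_ole a b A : ole a b -> worm_ge b A -> worm_ge a A.
Proof. intros h; apply Forall_impl; intros c; exact (ole_trans _ _ _ h). Qed.

Lemma worm_ge_olt a b A : olt a b -> worm_ge b A -> worm_gt a A.
Proof.
intros h; apply Forall_impl; intros c [l|<-]; [exact (olt_trans _ _ _ h l) | exact h].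
Qed.

Lemma worm_gt_ge a A : worm_gt a A -> worm_ge a A.
Proof. apply Forall_impl; intros c h; left; exact h. Qed.

Lemma worm_min A : A <> [] -> exists m, In m A /\ worm_ge m A.
Proof.
induction A as [|a [|b A] IH]; intros n; [congruence| |].
- exists a; split; [left; reflexivity|].
  constructor; [right; reflexivity | constructor].
- destruct IH as (m & i & g); [discriminate|].
  assert (H : ole a m \/ olt m a).
  { destruct (olt_total a m) as [h|[h|h]]; unfold ole; auto. }
  destruct H as [h|h].
  + exists a; split; [left; reflexivity|].
    constructor; [right; reflexivity | exact (worm_ge_ole _ _ _ h g)].
  + exists m; split; [right; exact i | constructor; [left; exact h | exact g]].
Qed.

(** What is left of a worm with modalities at least [m] from its first [m] on; empty when [m] does
    not occur. *)
Definition remainder (m : ordinal) (R : worm) : Prop :=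
  R = [] \/ exists R', R = m :: R' /\ worm_ge m R'.

Lemma worm_split m A : worm_ge m A ->
  exists H R, A = H ++ R /\ worm_gt m H /\ remainder m R.
Proof.
induction 1 as [|a A [l|<-] g (H & R & -> & h & r)].
- exists [], []; repeat split; [constructor | left; reflexivity].
- exists (a :: H), R; repeat split; [constructor; assumption | exact r].
- exists [], (m :: H ++ R); repeat split; [constructor|].
  right; exists (H ++ R); split; [reflexivity | exact g].
Qed.

(** Ensures that cutting off the remainders decreases the length in the inductions below. *)
Lemma remainder_length m H R : worm_gt m H -> In m (H ++ R) -> 0 < length R.
Proof.
intros h i; destruct R as [|x R]; simpl; [|lia].
rewrite app_nil_r in i; destruct (olt_irrefl m (proj1 (Forall_forall _ _) h m i)).
Qed.

(** * The Worm Calculus *)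

Lemma WC_refl A : WC A A.
Proof. induction A as [|a A IH]; [apply WC_top | exact (WC_nec a IH)]. Qed.

Lemma WC_ole a b A : ole b a -> WC (a :: A) (b :: A).
Proof. intros [h| ->]; [exact (WC_mono A h) | apply WC_refl]. Qed.

Lemma WC_appl A B : WC (A ++ B) A.
Proof. induction A as [|a A IH]; [apply WC_top | exact (WC_nec a IH)]. Qed.

(** Each modality of [A] is lowered to [m] and absorbed by contracting [m m B] to [m B]. *)
Lemma WC_appr m A B : worm_ge m A -> WC (A ++ m :: B) (m :: B).
Proof.
induction 1 as [|a A l g IH]; [apply WC_refl|].
apply WC_cut with (a :: m :: B); [exact (WC_nec a IH)|].
apply WC_cut with (m :: m :: B); [exact (WC_ole _ _ _ l) | apply WC_trans].
Qed.

Lemma WC_remainder m A R : worm_ge m A -> remainder m R -> WC (A ++ R) R.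
Proof.
intros g [->|(R' & -> & _)]; [apply WC_top | exact (WC_appr _ _ _ g)].
Qed.

(** Together with [WC_appl] and [WC_remainder], this makes [H ++ R] the conjunction of [H] and [R]
    in WC. *)
Lemma WC_glue m X H R : worm_gt m H -> remainder m R ->
  WC X H -> WC X R -> WC X (H ++ R).
Proof.
intros h [->|(R' & -> & _)] x r; [rewrite app_nil_r; exact x|].
apply WC_app; [apply worm_ge_osucc, h | exact x | exact r].
Qed.

(** Equivalence, or one worm deriving a diamond of the other. Since [m] occurs in the worms, it can
    be lowered to any common lower bound of their modalities. *)
Definition comparison (A B : worm) : Prop :=
  WC A B /\ WC B A \/
  exists m, In m (A ++ B) /\ worm_ge m (A ++ B) /\
    (WC A (m :: B) \/ WC B (m :: A)).

Lemma comparison_sym A B : comparison A B -> comparison B A.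
Proof.
intros [[h h']|(m & i & g & h)]; [left; auto|].
right; exists m; split; [|split]; [| |tauto].
- apply in_app_iff in i; apply in_app_iff; tauto.
- unfold worm_ge in *; rewrite Forall_app in *; tauto.
Qed.

Lemma comparison_at m A B : worm_ge m A -> worm_ge m B -> comparison A B ->
  WC A B /\ WC B A \/ WC A (m :: B) \/ WC B (m :: A).
Proof.
intros gA gB [h|(k & i & _ & h)]; [left; exact h|right].
assert (l : ole m k).
{ apply in_app_iff in i; destruct i as [i|i].
  - exact (proj1 (Forall_forall _ _) gA k i).
  - exact (proj1 (Forall_forall _ _) gB k i). }
destruct h as [h|h]; [left|right]; exact (WC_cut h (WC_ole _ _ _ l)).
Qed.

(** [H ++ R] derives [m R'], so [R'] deriving [B] or [m B] gives the left side; [B] deriving [m R']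
    is the right side. *)
Lemma comparison_remainder m H R B :
  worm_gt m H -> remainder m R -> worm_ge m B ->
  (forall R', R = m :: R' -> comparison R' B) ->
  WC (H ++ R) (m :: B) \/ WC B R.
Proof.
intros h [->|(R' & -> & g)] gB IH; [right; apply WC_top|].
assert (r : WC (H ++ m :: R') (m :: R')) by apply WC_appr, worm_gt_ge, h.
destruct (comparison_at m R' B g gB (IH R' eq_refl)) as [[c _]|[c|c]].
- left; exact (WC_cut r (WC_nec m c)).
- left; exact (WC_cut r (WC_cut (WC_nec m c) (WC_trans m B))).
- right; exact c.
Qed.

(** [R] is attached while the leading modality is still [k > m], as gluing demands; only then is [k]
    lowered to [m]. *)
Lemma WC_glue_dia m k X H R : olt m k -> worm_gt m H -> remainder m R ->
  WC X (k :: H) -> WC X R -> WC X (m :: H ++ R).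
Proof.
intros l h r x xr; apply WC_cut with (k :: H ++ R); [|exact (WC_mono _ l)].
apply (WC_glue m X (k :: H) R); [constructor; assumption | exact r | exact x | exact xr].
Qed.

(** Induction on total length, cutting both worms at their common least modality. Comparing each
    remainder, less its leading [m], with the other worm settles the matter unless each worm derives
    the other's remainder; then the heads decide. *)
Lemma worm_comparison A B : comparison A B.
Proof.
remember (length (A ++ B)) as n eqn:e; revert A B e.
induction n as [n IH] using lt_wf_ind; intros A B ->.
destruct (classic (A ++ B = [])) as [e|e].
{ apply app_eq_nil in e; destruct e as [-> ->]; left; split; apply WC_top. }
destruct (worm_min _ e) as (m & i & g); clear e.
pose proof (proj1 (Forall_app _ _ _) g) as [gA gB].
destruct (worm_split m A gA) as (HA & RA & -> & hA & rA).
destruct (worm_split m B gB) as (HB & RB & -> & hB & rB).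
assert (len : 0 < length RA + length RB).
{ apply in_app_iff in i; destruct i as [i|i];
    apply remainder_length in i; auto; lia. }
assert (pA : WC (HA ++ RA) RA) by (apply WC_remainder with m; [apply worm_gt_ge, hA | exact rA]).
assert (pB : WC (HB ++ RB) RB) by (apply WC_remainder with m; [apply worm_gt_ge, hB | exact rB]).
destruct (comparison_remainder m HA RA (HB ++ RB)) as [c|cB]; auto.
{ intros R' ->; eapply IH; [|reflexivity]; rewrite !length_app; simpl; lia. }
{ right; exists m; auto. }
destruct (comparison_remainder m HB RB (HA ++ RA)) as [c|cA]; auto.
{ intros R' ->; eapply IH; [|reflexivity]; rewrite !length_app; simpl; lia. }
{ right; exists m; auto. }
assert (c : comparison HA HB).
{ eapply IH; [|reflexivity]; rewrite !length_app; lia. }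
destruct c as [[c c']|(k & ik & _ & c)].
- left; split; apply WC_glue with m; auto; eapply WC_cut; try apply WC_appl; assumption.
- assert (l : olt m k).
  { exact (proj1 (Forall_forall _ _) (proj2 (Forall_app _ _ _) (conj hA hB)) k ik). }
  right; exists m; split; [exact i|split; [exact g|]].
  destruct c as [c|c]; [left|right]; apply WC_glue_dia with k; auto;
    eapply WC_cut; try apply WC_appl; assumption.
Qed.

(** Behind a leading [m] every outcome of the comparison becomes a derivation, a doubled [m] being
    contracted. *)
Lemma remainder_linear m R S : remainder m R -> remainder m S -> WC R S \/ WC S R.
Proof.
intros [->|(R' & -> & gR)]; [right; apply WC_top|].
intros [->|(S' & -> & gS)]; [left; apply WC_top|].
destruct (comparison_at m R' S' gR gS (worm_comparison R' S')) as [[c _]|[c|c]].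
- left; exact (WC_nec m c).
- left; exact (WC_cut (WC_nec m c) (WC_trans m S')).
- right; exact (WC_cut (WC_nec m c) (WC_trans m R')).
Qed.

(** By linearity, the stronger remainder acts as the conjunction of the two. *)
Lemma remainder_meet m R S : remainder m R -> remainder m S ->
  exists M, remainder m M /\ WC M R /\ WC M S /\
    forall X, WC X R -> WC X S -> WC X M.
Proof.
intros r s; destruct (remainder_linear m R S r s) as [c|c].
- exists R; split; [exact r|]; split; [apply WC_refl|]; split; auto.
- exists S; split; [exact s|]; split; [exact c|]; split; [apply WC_refl | auto].
Qed.

(* The bound on the modalities of [C] lets it be extended by a remainder. *)
Lemma WC_dia_and X a b A B : olt b a -> WC X (a :: A) -> WC X (b :: B) ->
  exists C, WC C A /\ WC C (b :: B) /\ WC X (a :: C) /\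
    forall c, worm_gt c A -> worm_gt c (b :: B) -> worm_gt c C.
Proof.
remember (length (A ++ b :: B)) as n eqn:e; revert A B e.
induction n as [n IH] using lt_wf_ind; intros A B -> l xA xB.
destruct (worm_min (A ++ b :: B)) as (m & i & g); [destruct A; discriminate|].
pose proof (proj1 (Forall_app _ _ _) g) as [gA gB].
destruct (worm_split m A gA) as (HA & RA & -> & hA & rA).
(* [c] lies below all modalities of both worms, hence below [m], which bounds [H] and [M] from
   below. *)
assert (bound : forall c H M, worm_gt c (HA ++ RA) -> worm_gt c (b :: B) ->
          worm_gt m H -> remainder m M -> worm_gt c (H ++ M)).
{ intros c H M cA cB h r.
  assert (lm : olt c m).
  { exact (proj1 (Forall_forall _ _) (proj2 (Forall_app _ _ _) (conj cA cB)) m i). }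
  apply Forall_app; split.
  - exact (worm_ge_olt _ _ _ lm (worm_gt_ge _ _ h)).
  - destruct r as [->|(M' & -> & gM)]; constructor; [exact lm|].
    exact (worm_ge_olt _ _ _ lm gM). }
assert (lma : olt m a) by exact (ole_olt_trans _ _ _ (Forall_inv gB) l).
assert (xHA : WC X (a :: HA)) by exact (WC_cut xA (WC_nec a (WC_appl HA RA))).
assert (xRA : WC X RA).
{ apply WC_cut with (1 := xA), (WC_remainder m (a :: HA)); [|exact rA].
  apply worm_gt_ge; constructor; assumption. }
assert (glue : forall H M, worm_gt m H -> remainder m M ->
          WC X (a :: H) -> WC X M -> WC X (a :: H ++ M)).
{ intros H M h r; apply (WC_glue m X (a :: H)); [constructor; assumption | exact r]. }
assert (split : forall H M, WC H HA -> WC M RA -> worm_gt m H -> remainder m M ->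
          WC (H ++ M) (HA ++ RA)).
{ intros H M cH cM h r; apply WC_glue with m; auto.
  - exact (WC_cut (WC_appl H M) cH).
  - exact (WC_cut (WC_remainder m H M (worm_gt_ge _ _ h) r) cM). }
(* Either [m < b] and [B] is cut as well, or [m = b] and [b :: B] is itself a remainder. *)
destruct (Forall_inv gB) as [lmb|<-].
- destruct (worm_split m B (Forall_inv_tail gB)) as (HB & RB & -> & hB & rB).
  change (b :: HB ++ RB) with ((b :: HB) ++ RB) in *.
  assert (hB' : worm_gt m (b :: HB)) by (constructor; assumption).
  assert (xRB : WC X RB).
  { apply WC_cut with (1 := xB), WC_remainder with m; [apply worm_gt_ge, hB' | exact rB]. }
  assert (len : 0 < length RA + length RB).
  { apply in_app_iff in i; destruct i as [i|i];
      apply remainder_length in i; auto; lia. }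
  destruct (remainder_meet m RA RB rA rB) as (M & rM & MA & MB & meet).
  (* The induction hypothesis serves the heads; the two remainders are replaced by their meet
     [M]. *)
  destruct (IH (length (HA ++ b :: HB))) with (A := HA) (B := HB)
    as (C & CA & CB & xC & gC);
    [|reflexivity|exact l|exact xHA|exact (WC_cut xB (WC_appl _ _))|].
  { rewrite !length_app; simpl; lia. }
  (* The bound carried through the induction is what allows [M] to be glued to [C]. *)
  assert (hC : worm_gt m C) by (apply gC; assumption).
  exists (C ++ M); split; [|split; [|split]]; auto.
  apply WC_glue with m; auto.
  + exact (WC_cut (WC_appl C M) CB).
  + exact (WC_cut (WC_remainder m C M (worm_gt_ge _ _ hC) rM) MB).
- assert (rB : remainder m (m :: B)).
  { right; exists B; split; [reflexivity | exact (Forall_inv_tail gB)]. }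
  destruct (remainder_meet m RA (m :: B) rA rB) as (M & rM & MA & MB & meet).
  (* With no head in front of [m :: B], [HA] itself takes the place of [C]. *)
  exists (HA ++ M); split; [|split; [|split]]; auto.
  + apply split; auto; apply WC_refl.
  + exact (WC_cut (WC_remainder m HA M (worm_gt_ge _ _ hA) rM) MB).
Qed.

(** * Worm calculus and reflection calculus *)

(** [RC_dia_and] moves the second conjunct under the modalities of [B] one at a time, each being
    above [a]. *)
Lemma RC_app (V : Type) a (B C : worm) : worm_gt a B ->
  RC (And (worm_form V B) (worm_form V (a :: C))) (worm_form V (B ++ a :: C)).
Proof.
induction 1 as [|b B l g IH]; simpl; [apply RC_andr|].
eapply RC_cut; [apply RC_dia_and, l | apply RC_nec, IH].
Qed.

Lemma WC_RC (V : Type) A B : WC A B -> RC (worm_form V A) (worm_form V B).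
Proof.
induction 1; simpl.
- apply RC_top.
- apply RC_dia_trans.
- apply RC_dia_mono; assumption.
- eapply RC_cut; eassumption.
- apply RC_nec; assumption.
- apply RC_cut with (And (worm_form V B) (worm_form V (a :: C)));
    [apply RC_and; assumption | apply RC_app, worm_ge_osucc; assumption].
Qed.

(** Kripke semantics with worms as worlds, [A] being [a]-accessible from [X] when [X] derives
    [a :: A]. Variables hold everywhere, so that truth persists to every worm deriving a given
    one. *)
Fixpoint forces (V : Type) (phi : form V) (X : worm) : Prop :=
  match phi with
  | Var _ | Top => True
  | And phi psi => forces V phi X /\ forces V psi X
  | Dia a phi => exists A, forces V phi A /\ WC X (a :: A)
  end.

Lemma forces_WC V phi X Y : WC Y X -> forces V phi X -> forces V phi Y.
Proof.
intros h; induction phi as [p| |phi IH1 psi IH2|a phi IH]; simpl; auto.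
- tauto.
- intros (A & f & x); exists A; split; [exact f | exact (WC_cut h x)].
Qed.

Lemma forces_worm V A X : forces V (worm_form V A) X <-> WC X A.
Proof.
revert X; induction A as [|a A IH]; intros X; simpl.
- split; [intros _; apply WC_top | auto].
- split.
  + intros (B & f & x); apply IH in f; exact (WC_cut x (WC_nec a f)).
  + intros x; exists A; split; [apply IH, WC_refl | exact x].
Qed.

Lemma RC_forces V (phi psi : form V) X :
  RC phi psi -> forces V phi X -> forces V psi X.
Proof.
intros h; revert X; induction h; simpl; intros X; try tauto.
- intros (A & (B & f & x) & y); exists B; split; [exact f|].
  exact (WC_cut (WC_cut y (WC_nec a x)) (WC_trans a B)).
- intros (A & f & x); exists A; split; [exact f | exact (WC_cut x (WC_mono A H))].
- intros [(A & f & x) (B & f' & x')].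
  (* [C] inherits [phi] from [A] and has [B] as its witness for the diamond [b]. *)
  destruct (WC_dia_and X a b A B H x x') as (C & CA & CB & xC & _).
  exists C; split; [split|exact xC].
  + exact (forces_WC V phi A C CA f).
  + exists B; split; assumption.
- auto.
- auto.
- intros (A & f & x); exists A; auto.
Qed.

Theorem theorem6p2 (V : Type) (A B : worm) :
  RC (worm_form V A) (worm_form V B) <-> WC A B.
Proof.
split; [|apply WC_RC].
(* [A] forces its own formula; soundness carries this to the formula of [B], where forcing is
   derivability. *)
intros h; apply (forces_worm V), (RC_forces V _ _ A h), forces_worm, WC_refl.
Qed.
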